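(* Let $\Lambda\subseteq\mathbb{R}^n$ be a lattice of full rank, let $v_1,\ldots,v_k\in\mathbb{R}^n$ be such that $v_i-v_j\notin\Lambda$ for all $1\le i<j\le k$, and let $V=\bigcup_{i=1}^k(v_i+\Lambda)$. Let $D\subseteq\mathbb{R}^n$ be bounded and Lebesgue-measurable. If $D+V=\mathbb{R}^n$, then $\operatorname{vol}(D)\geq\frac{\det(\Lambda)}{k}$.
   Context: A lattice is a discrete subgroup of $\mathbb{R}^n$, always assumed to be of full rank; writing $\Lambda=B\mathbb{Z}^n$ with $B\in\mathbb{R}^{n\times n}$ invertible, its determinant is $\det(\Lambda)=|\det(B)|$. $\operatorname{vol}$ denotes Lebesgue measure and $D+V=\{d+v : d\in D, v\in V\}$ is the Minkowski sum. Here $k\ge1$ and $n\ge 1$ are integers. *)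

(* Defs.v *)
From HB Require Import structures.
From mathcomp Require Import all_boot all_order all_algebra.
From mathcomp Require Import all_classical all_reals all_analysis.

Set Implicit Arguments.
Unset Strict Implicit.
Unset Printing Implicit Defensive.

Import Order.TTheory GRing.Theory Num.Theory.
Import numFieldNormedType.Exports.

Local Open Scope classical_set_scope.
Local Open Scope ring_scope.

Section Lebesgue.
Context {R : realType} {n : nat}.
Implicit Types (a b : 'cV[R]_n) (A : set 'cV[R]_n).

Definition open_box a b : set 'cV[R]_n :=
  [set x | forall j, a j 0 < x j 0 < b j 0].

(* Only meant for a <= b componentwise. *)
Definition box_volume a b : R := \prod_j (b j 0 - a j 0).

(* The boxes may be degenerate (hence empty when n > 0), so that finite covers
   are included. *)
Definition box_cover A : set (nat -> 'cV[R]_n * 'cV[R]_n) :=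
  [set F : nat -> 'cV[R]_n * 'cV[R]_n |
           (forall i j, (F i).1 j 0 <= (F i).2 j 0) /\
           A `<=` \bigcup_i open_box (F i).1 (F i).2].

(* For n = 0 every box is the whole space, so this is Lebesgue outer measure
   only for n > 0. *)
Definition lebesgue_outer A : \bar R :=
  ereal_inf [set (\sum_(i <oo) (box_volume (F i).1 (F i).2)%:E)%E
            | F in box_cover A].

(* Caratheodory's criterion: this is the full (complete) Lebesgue
   sigma-algebra, not just the Borel sets. *)
Definition lebesgue_measurable A : Prop :=
  caratheodory_measurable lebesgue_outer A.

(* The volume of a Lebesgue-measurable set is its outer measure. *)
Definition vol A : \bar R := lebesgue_outer A.

End Lebesgue.

Section OuterMeasure.
Context {R : realType} {n : nat}.
Local Notation mu := (@lebesgue_outer R n.+1).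

Let cover_ge0 A F i : @box_cover R n.+1 A F ->
  (0 <= (box_volume (F i).1 (F i).2)%:E)%E.
Proof.
by move=> [F0 _]; rewrite lee_fin; apply: prodr_ge0 => j _; rewrite subr_ge0.
Qed.

Lemma lebesgue_outer_ge0 A : (0 <= mu A)%E.
Proof.
apply: le_ereal_inf_tmp => _ [F FA <-]; apply: nneseries_ge0 => i _ _.
exact: cover_ge0 FA.
Qed.

Lemma le_lebesgue_outer : {homo mu : A B / A `<=` B >-> (A <= B)%E}.
Proof.
move=> A B AB; apply: ereal_inf_le_tmp => _ [F [F0 FB] <-].
by exists F => //; split=> //; exact: subset_trans FB.
Qed.

Lemma lebesgue_outer0 : mu set0 = 0%E.
Proof.
apply/eqP; rewrite eq_le lebesgue_outer_ge0 andbT.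
apply: ereal_inf_lbound; exists (fun=> (0, 0)); first by split=> [i j|] //=.
apply: eseries0 => i _ _ /=.
by rewrite /box_volume big_ord_recl subrr mul0r.
Qed.

Lemma lebesgue_outer_sigma_subadditive : sigma_subadditive mu.
Proof.
move=> A; have [[i ioo]|] := pselect (exists i, mu (A i) = +oo%E).
  rewrite (eseries_pinfty _ _ ioo) ?leey// => j _.
  by rewrite -ltNye (lt_le_trans _ (lebesgue_outer_ge0 _)).
rewrite -forallNE => Aoo.
apply/lee_addgt0Pr => e e0.
rewrite (le_trans _ (epsilon_trick _ _ (ltW e0)))//; last first.
  by move=> i; exact: lebesgue_outer_ge0.
pose vo (c : 'cV[R]_n.+1 * 'cV[R]_n.+1) := (box_volume c.1 c.2)%:E.
pose P i F := box_cover (A i) F /\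
  (\sum_(k <oo) vo (F k) <= mu (A i) + (e / (2 ^ i.+1)%:R)%:E)%E.
have [G PG] : {G & forall i, P i (G i)}.
  apply: (@choice _ _ P) => i.
  have en : 0 < e / (2 ^ i.+1)%:R :> R by rewrite divr_gt0// ltr0n expn_gt0.
  have mufin : mu (A i) \is a fin_num.
    by rewrite ge0_fin_numE ?lebesgue_outer_ge0// ltey; apply/eqP/Aoo.
  have [_ [F FA <-] lt] := lb_ereal_inf_adherent en mufin.
  by exists F; split=> //; exact: ltW.
have Gge0 i j : (0 <= vo (G i j))%E by exact: cover_ge0 (PG i).1.
have [f] : exists f : nat -> nat * nat, bijective f.
  have /card_esym/ppcard_eqP[g] := card_nat2.
  exists g; exists (g^-1)%FUN => x; first by rewrite funK ?inE.
  by rewrite invK ?inE.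
move=> fbij; have [g fK gK] := fbij.
apply: (@le_trans _ _ (\sum_(i <oo) \sum_(j <oo) vo (G i j))%E).
  apply: (@le_trans _ _ (\sum_(i <oo) vo (uncurry G (f i)))%E).
    apply: ereal_inf_lbound; exists (uncurry G \o f) => //; split=> [k j|].
      by rewrite /= /uncurry; case: (f k) => p q; exact: (PG p).1.1.
    move=> x [i _ /(PG i).1.2[j _ Gx]].
    by exists (g (i, j)) => //; rewrite /= gK.
  have -> : (\sum_(i <oo) vo (uncurry G (f i)) =
             \esum_(p in [set: nat * nat]) vo (uncurry G p))%E.
    rewrite nneseries_esumT; last by move=> i; case: (f i) => p q; exact: Gge0.
    rewrite (reindex_esum [set: nat] [set: nat * nat] f)//.
    by split=> //; [move=> x y _ _; exact: (bij_inj fbij)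
                   | move=> y _; exists (g y)].
  rewrite nneseries_esumT; last by move=> i; exact: nneseries_ge0.
  under [leRHS]eq_esum do rewrite nneseries_esumT//.
  rewrite esum_esum//= le_eqVlt; apply/orP; left; apply/eqP.
  transitivity (\esum_(p in [set: nat * nat]) vo (G p.1 p.2))%E.
    by apply: eq_esum => -[].
  by congr esum; apply/seteqP; split=> -[].
apply: lee_nneseries => [i _ _|i _]; last exact: (PG i).2.
exact: nneseries_ge0.
Qed.

HB.instance Definition _ := isOuterMeasure.Build R 'cV[R]_n.+1 mu
  lebesgue_outer0 lebesgue_outer_ge0 le_lebesgue_outer
  lebesgue_outer_sigma_subadditive.

End OuterMeasure.

Section Lattice.
Context {R : realType} {n : nat}.
Implicit Types (B : 'M[R]_n) (L D V : set 'cV[R]_n).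

(* B Z^n; vectors of R^n are columns. *)
Definition Zspan B : set 'cV[R]_n :=
  [set B *m map_mx intr z | z in [set: 'cV[int]_n]].

Definition full_lattice L : Prop :=
  [/\ L 0,
      forall x y, L x -> L y -> L (x - y),
      L `<=` isolated L
    & exists2 M : 'M[R]_n, M \in unitmx & forall j, L (col j M)].

(* |det B| for any basis B of L: the choice is irrelevant, see lattice_detE. *)
Definition lattice_det L : R :=
  xget 0 [set `|\det B| | B in [set B | B \in unitmx /\ L = Zspan B]].

Definition minkowski_sum D V : set 'cV[R]_n := [set d + w | d in D & w in V].

Lemma Zspan_sub_det B C : B \in unitmx -> C \in unitmx ->
  Zspan C `<=` Zspan B -> `|\det B| <= `|\det C|.
Proof.
move=> Bu Cu CB.
have colE (j : 'I_n) : exists z : 'cV[int]_n, col j C = B *m map_mx intr z.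
  have [|z _ <-] := CB (col j C); last by exists z.
  exists (delta_mx j 0) => //; rewrite colE; congr (_ *m _).
  by apply/matrixP => i k; rewrite !mxE; case: (_ && _).
have [z zE] := choice colE.
pose U : 'M[int]_n := \matrix_(i, j) z j i 0.
have CE : C = B *m map_mx intr U.
  apply/matrixP => i j; have /matrixP/(_ i 0) := zE j; rewrite !mxE => ->.
  by apply: eq_bigr => l _; rewrite !mxE.
have dC : \det C != 0 by rewrite -unitfE -unitmxE.
rewrite CE det_mulmx det_map_mx normrM ler_peMr//.
have : \det U != 0.
  by apply: contraNneq dC => U0; rewrite CE det_mulmx det_map_mx U0 mulr0.
by rewrite -normr_gt0 gtz0_ge1 -(ler_int R) intr_norm.
Qed.

Lemma lattice_detE B L : B \in unitmx -> L = Zspan B ->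
  lattice_det L = `|\det B|.
Proof.
move=> Bu LB; apply: xget_unique; first by exists B.
move=> _ [C [Cu LC] <-]; apply/eqP; rewrite eq_le.
by apply/andP; split; apply: Zspan_sub_det => //; rewrite -LB -LC.
Qed.

End Lattice.

(* Main.v *)
(* If the lattice is B Z^n, then A = B^-1 D satisfies A + Z^n + {w_1, .., w_k} =
   R^n with w_i = B^-1 v_i, and it suffices to show k vol(A) >= 1.  As A is
   bounded, the cube [0, N]^n is covered by the translates of A by w_i + z with
   z among (N + c)^n integer points, c independent of N; hence
   N^n <= k (N + c)^n vol(A), and N tends to infinity.

   The only property of the volume that is not immediate is
   vol(B^-1 D) <= |det B|^-1 vol(D). By countable subadditivity a linear map
   needs to be studied on boxes only, and an LUP decomposition reduces to
   permutations, diagonal matrices and transvections. The image of a box under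
   a transvection is covered by thin slices, each in a box of almost the right
   volume. The inequality vol([0, 1]^n) >= 1 is proved by counting the points
   of a fine grid in a finite cover by boxes. *)
Require Import Defs.
From mathcomp Require Import all_boot all_order all_algebra.
From mathcomp Require Import all_classical all_reals all_analysis.
From mathcomp Require Import fingroup perm lra ring zify.

Import Order.TTheory GRing.Theory Num.Theory.
Import numFieldNormedType.Exports.

Local Open Scope classical_set_scope.
Local Open Scope ring_scope.

(** * Limits in the mesh size, and counting grid points *)

(** Every limiting argument below yields, for all m, a bound that is polynomial in the mesh 1/(m+1);
    continuity at 0 then removes the error. *)
Lemma le_horner0 {R : realType} (p : {poly R}) (c : R) :
  (forall m, c <= p.[m.+1%:R^-1]) -> c <= p.[0].
Proof.
move=> cp.
have pcvg : p.[m.+1%:R^-1] @[m --> \oo] --> p.[0].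
  apply: (@cvg_comp _ _ _ (@harmonic R) (horner p) _ (nbhs (0 : R))).
    exact: cvg_harmonic.
  exact: continuous_horner.
rewrite -(cvg_lim _ pcvg)//; apply: limr_ge.
  by apply/cvg_ex; eexists; exact: pcvg.
exact: nearW.
Qed.

Lemma lee_horner0 {R : realType} (p : {poly R}) (x : \bar R) :
  (forall m, (x <= p.[m.+1%:R^-1]%:E)%E) -> (x <= p.[0]%:E)%E.
Proof.
case: x => [c| |] xp; last by rewrite leNye.
  by rewrite lee_fin; apply: le_horner0 => m; rewrite -lee_fin.
by have := xp 0%N.
Qed.

(** If q and r are the extreme indices counted, then (r - q) h < b - a; the summand 1 comes from
    counting both ends. *)
Lemma card_ord_itv {R : realType} (m : nat) (a b h : R) : 0 < h -> a <= b ->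
  (#|[pred p : 'I_m | (a < p%:R * h) && (p%:R * h < b)]|%:R <= (b - a) / h + 1).
Proof.
move=> h0 ab; set P := [pred p : 'I_m | _].
have ba : 0 <= (b - a) / h by rewrite divr_ge0 ?subr_ge0// ltW.
have [p0 Pp0|P0] := pickP P; last by rewrite (eq_card0 P0) addr_ge0.
case: (@arg_minnP _ p0 P val Pp0) => q Pq qmin.
case: (@arg_maxnP _ p0 P val Pp0) => r Pr rmax.
have PS : (#|P| <= (r - q).+1)%N.
  rewrite cardE -(size_map val) -[leqRHS](size_iota q).
  apply: uniq_leq_size => [|k].
    by rewrite map_inj_uniq ?enum_uniq//; exact: val_inj.
  move=> /mapP[p]; rewrite mem_enum => Pp ->; rewrite mem_iota.
  by have := qmin _ Pp; have := rmax _ Pp => /=; lia.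
have qr : (q <= r)%N by exact: qmin.
move: Pq Pr => /andP[aq _] /andP[_ rb].
rewrite (le_trans (_ : _ <= (r - q).+1%:R)) ?ler_nat// -natr1 lerD2r natrB//.
by rewrite ler_pdivlMr// mulrBl lerB// ltW.
Qed.

(** The cube contains (m+1)^n grid points of mesh h = 1/(m+1), and a box with sides s_j contains at
    most the product of the s_j / h + 1 of them. Multiplying by h^n turns the factors into s_j + h,
    and h tends to 0. *)
Lemma unit_cube_cover {R : realType} {n : nat} {I : finType}
    (F : I -> 'cV[R]_n * 'cV[R]_n) :
  (forall i j, (F i).1 j 0 <= (F i).2 j 0) ->
  [set x : 'cV[R]_n | forall j, 0 <= x j 0 <= 1] `<=`
    \bigcup_i open_box (F i).1 (F i).2 ->
  1 <= \sum_i box_volume (F i).1 (F i).2.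
Proof.
move=> F_le FC.
pose p : {poly R} :=
  \sum_i \prod_j ('X + ((F i).2 j 0 - (F i).1 j 0)%:P).
have -> : \sum_i box_volume (F i).1 (F i).2 = p.[0].
  rewrite /p horner_sum; apply: eq_bigr => i _; rewrite horner_prod.
  by apply: eq_bigr => j _; rewrite !hornerE.
apply: le_horner0 => m.
set h : R := m.+1%:R^-1.
have h0 : 0 < h by rewrite invr_gt0.
pose G := {ffun 'I_n -> 'I_m.+1}.
pose inb (i : I) (j : 'I_n) :=
  [pred q : 'I_m.+1 | ((F i).1 j 0 < q%:R * h) && (q%:R * h < (F i).2 j 0)].
(* Double counting of the pairs formed by a grid point and a box containing it. *)
have cover1 : (#|G| <= \sum_i #|(family (inb i) : {pred G})|)%N.
  rewrite -sum1_card.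
  rewrite (eq_bigr (fun i => \sum_(g : G) (g \in family (inb i) : nat))%N).
    rewrite exchange_big; apply: leq_sum => g _.
    have [|i _ gF] := FC (\col_j ((g j)%:R * h)).
      move=> j; rewrite mxE mulr_ge0 ?ler0n ?ltW//= /h ltr_pdivrMr// mul1r.
      by rewrite ltr_nat; exact: ltn_ord.
    rewrite (bigD1 i)//= (_ : g \in _ = true)//.
    by apply/familyP => j; have := gF j; rewrite !mxE inE.
  move=> i _; rewrite -sum1_card [LHS]big_mkcond; apply: eq_bigr => g _.
  by rewrite fun_if; case: (g \in _).
have : (m.+1%:R ^+ n : R) <=
    \sum_i \prod_j (((F i).2 j 0 - (F i).1 j 0) / h + 1).
  move: cover1; rewrite card_ffun !card_ord -(ler_nat R) natrX.
  move=> /le_trans; apply.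
  rewrite natr_sum; apply: ler_sum => i _.
  rewrite card_family foldrE big_map big_enum/= natr_prod.
  apply: ler_prod => j _.
  by rewrite ler0n card_ord_itv.
rewrite -(ler_pM2l (exprn_gt0 n h0)) -exprMn mulVf ?expr1n//.
move=> /le_trans; apply.
rewrite horner_sum mulr_sumr le_eqVlt; apply/orP; left; apply/eqP.
apply: eq_bigr => i _.
under eq_bigr do rewrite -[X in _ + X](divff (lt0r_neq0 h0)) -mulrDl.
rewrite horner_prod big_split/= prodr_const card_ord mulrCA -exprMn.
rewrite divff ?gt_eqF// expr1n mulr1; apply: eq_bigr => j _.
by rewrite hornerD hornerX hornerC addrC.
Qed.

(** * Outer measure of boxes *)

Section BoxMeasure.
Context {R : realType} {n : nat}.
Local Notation mu := (@lebesgue_outer R n.+1).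
Implicit Types (a b : 'cV[R]_n.+1) (A X : set 'cV[R]_n.+1).

Definition closed_box a b : set 'cV[R]_n.+1 :=
  [set x | forall j, a j 0 <= x j 0 <= b j 0].

(** Compactness of the cube cuts a countable cover by open boxes down to a finite one. Transposition
    moves the topological argument to row vectors. *)
Lemma unit_cube_outer_ge1 : (1 <= mu (closed_box 0 (const_mx 1%R)))%E.
Proof.
apply: le_ereal_inf_tmp => _ [F [F0 FQ] <-].
pose Q := [set x : 'rV[R]_n.+1 | forall i, x ord0 i \in `[0, 1]].
pose f (i : nat) : set 'rV[R]_n.+1 := trmx @^-1` open_box (F i).1 (F i).2.
have Qc : compact Q.
  apply: (@rV_compact _ _ (fun=> `[0 : R, 1]%classic)) => _.
  exact: segment_compact.
have Qf : Q `<=` \bigcup_i f i.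
  move=> x Qx; have [|i _ Fx] := FQ x^T; last by exists i.
  by move=> j; rewrite !mxE; have := Qx j; rewrite /= in_itv/=.
have fo i : [set: nat] i -> open (f i).
  move=> _; rewrite openE => x fx.
  have : nbhs x [set y : 'rV[R]_n.+1 | forall j,
      (F i).1 j 0 < y ord0 j < (F i).2 j 0].
    apply: (@filter_forall _ _ (fun j (y : 'rV[R]_n.+1) =>
      (F i).1 j 0 < y ord0 j < (F i).2 j 0) (nbhs x)) => j.
    apply: (@coord_continuous _ _ _ ord0 j x
      [set t | (F i).1 j 0 < t < (F i).2 j 0]).
    have : x ord0 j \in `](F i).1 j 0, (F i).2 j 0[.
      by rewrite in_itv/=; have := fx j; rewrite mxE.
    by move=> /near_in_itvoo; apply: filterS => t; rewrite in_itv.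
  by apply: filterS => y yF j; rewrite mxE.
move: Qc; rewrite compact_cover => /(_ _ _ _ fo Qf)[D' _ QD'].
(* [N] exceeds every index of the finite subcover, so the first [N] boxes already cover the cube. *)
pose N := (\max_(i <- finmap.enum_fset D') i).+1.
apply: le_trans (nneseries_lim_ge N _); last first.
  by move=> i _ _; rewrite lee_fin prodr_ge0// => j _; rewrite subr_ge0.
rewrite big_mkord sumEFin lee_fin.
apply: (@unit_cube_cover _ _ 'I_N (F \o val)) => [i j|x x01]; first exact: F0.
have [|i iD' fx] := QD' x^T.
  by move=> j; have := x01 j; rewrite /= in_itv/= !mxE.
have iN : (i < N)%N by rewrite ltnS; exact: leq_bigmax_seq.
by exists (Ordinal iN) => //=; move: fx; rewrite /f/= trmxK.
Qed.

Lemma lebesgue_outer_fin (I : finType) (A : I -> set 'cV[R]_n.+1) :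
  (mu (\bigcup_i A i) <= \sum_i mu (A i))%E.
Proof.
have -> : \bigcup_i A i = \big[setU/set0]_(i : I) A i.
  by rewrite -bigcup_pred; congr bigcup; apply/seteqP; split.
elim/big_ind2 : _ => [|B x C y Bx Cy|//]; first by rewrite lebesgue_outer0.
exact: le_trans (outer_measureU2 mu _ _) (leeD Bx Cy).
Qed.

Lemma open_box_outer a b : (forall j, a j 0 <= b j 0) ->
  (mu (open_box a b) <= (box_volume a b)%:E)%E.
Proof.
move=> ab; apply: ereal_inf_lbound.
(* The padding boxes have volume 0 because the dimension is positive. *)
exists (fun i => if i == 0%N then (a, b) else (0, 0)).
  by split=> [[|i] j|x abx] //=; exists 0%N.
rewrite (@nneseries_split _ _ 0 1)//=; last first.
  by case=> [|i] _; rewrite lee_fin prodr_ge0// => j _; rewrite subr_ge0//= mxE.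
rewrite big_nat1 eseries0 ?adde0// => -[|i] // _ _.
by rewrite /box_volume big_ord_recl subrr mul0r.
Qed.

Lemma closed_box_outer a b : (forall j, a j 0 <= b j 0) ->
  (mu (closed_box a b) <= (box_volume a b)%:E)%E.
Proof.
move=> ab.
(* Volume of the open box obtained by widening every side by the variable at both ends. *)
pose p : {poly R} := \prod_j ('X *+ 2 + (b j 0 - a j 0)%:P).
have mup m : (mu (closed_box a b) <= p.[m.+1%:R^-1]%:E)%E.
  have m0 : 0 < m.+1%:R^-1 :> R by rewrite invr_gt0.
  set h := m.+1%:R^-1 : R.
  pose a' := a - const_mx h; pose b' := b + const_mx h.
  apply: (@le_trans _ _ (mu (open_box a' b'))).
    apply: le_lebesgue_outer => x abx j; rewrite !mxE.
    by have := abx j; rewrite -/h in m0 *; lra.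
  have -> : p.[h] = box_volume a' b'.
    rewrite horner_prod; apply: eq_bigr => j _.
    by rewrite hornerD hornerMn hornerX hornerC !mxE; ring.
  apply: open_box_outer => j; rewrite !mxE -/h in m0 *; have := ab j; lra.
have -> : box_volume a b = p.[0].
  by rewrite horner_prod; apply: eq_bigr => j _; rewrite !hornerE.
exact: lee_horner0.
Qed.

(** * Effect of translations and elementary linear maps on the outer measure *)

(** A one-sided bound on arbitrary sets is stable under composition; applied to an inverse map it
    also gives lower bounds. *)
Definition dilates (f : 'cV[R]_n.+1 -> 'cV[R]_n.+1) (c : R) :=
  forall X, (mu (f @` X) <= c%:E * mu X)%E.

Lemma dilates_open_box f c : 0 < c ->
  (forall a b, (forall j, a j 0 <= b j 0) ->
    (mu (f @` open_box a b) <= (c * box_volume a b)%:E)%E) ->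
  dilates f c.
Proof.
move=> c0 fc X; rewrite -lee_pdivrMl//.
apply: le_ereal_inf_tmp => _ [F [F0 FX] <-].
rewrite lee_pdivrMl// -nneseriesZl; last first.
  by move=> i _; rewrite lee_fin prodr_ge0// => j _; rewrite subr_ge0.
apply: (@le_trans _ _ (mu (\bigcup_i f @` open_box (F i).1 (F i).2))).
  apply: le_lebesgue_outer => _ [x Xx <-]; have [i _ Fx] := FX _ Xx.
  by exists i => //; exists x.
apply: (le_trans (lebesgue_outer_sigma_subadditive _)).
apply: lee_nneseries => i _; first by rewrite lebesgue_outer_ge0.
exact: fc.
Qed.

Lemma dilates_comp f g c d : 0 <= c ->
  dilates f c -> dilates g d -> dilates (f \o g) (c * d).
Proof.
move=> c0 fc gd X; rewrite -image_comp; apply: (le_trans (fc _)).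
by rewrite EFinM -muleA lee_wpmul2l.
Qed.

Lemma dilates_translation t : dilates (fun x => x + t) 1.
Proof.
apply: dilates_open_box => // a b ab; rewrite mul1r.
have -> : box_volume a b = box_volume (a + t) (b + t).
  by apply: eq_bigr => j _; rewrite !mxE; ring.
apply: le_trans (open_box_outer _ _ _); last by move=> j; rewrite !mxE lerD2r.
by apply: le_lebesgue_outer => _ [x xab <-] j; rewrite !mxE !ltrD2r.
Qed.

Lemma dilates_perm (s : 'S_n.+1) : dilates (mulmx (perm_mx s)) 1.
Proof.
apply: dilates_open_box => // a b ab; rewrite mul1r.
have -> : box_volume a b = box_volume (row_perm s a) (row_perm s b).
  rewrite /box_volume (reindex_perm s); apply: eq_bigr => j _.
  by rewrite !mxE.
apply: le_trans (open_box_outer _ _ _); last by move=> j; rewrite !mxE.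
by apply: le_lebesgue_outer => _ [x xab <-] j; rewrite -row_permE !mxE.
Qed.

Lemma dilates_diag (d : 'rV[R]_n.+1) : (forall j, d 0 j != 0) ->
  dilates (mulmx (diag_mx d)) (\prod_j `|d 0 j|).
Proof.
move=> d0; apply: dilates_open_box => [|a b ab].
  by apply: prodr_gt0 => j _; rewrite normr_gt0.
(* A negative diagonal entry swaps endpoints: the image has lower corner [lo a b] and upper corner
   [lo b a]. *)
pose lo (u v : 'cV[R]_n.+1) : 'cV[R]_n.+1 :=
  \col_j (d 0 j * (if 0 <= d 0 j then u j 0 else v j 0)).
have -> : \prod_j `|d 0 j| * box_volume a b = box_volume (lo a b) (lo b a).
  rewrite -big_split/=; apply: eq_bigr => j _; rewrite !mxE.
  case: (lerP 0 (d 0 j)) => dj; first by rewrite (ger0_norm dj); ring.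
  by rewrite (ltr0_norm dj); ring.
apply: le_trans (closed_box_outer _ _ _); last first.
  move=> j; rewrite !mxE; case: (lerP 0 (d 0 j)) => dj.
    by rewrite ler_wpM2l.
  by rewrite ler_wnM2l// ltW.
apply: le_lebesgue_outer => _ [x xab <-] j; rewrite mul_diag_mx !mxE.
have /andP[/ltW ax /ltW xb] := xab j.
case: (lerP 0 (d 0 j)) => dj; first by rewrite !ler_wpM2l.
by rewrite !ler_wnM2l// ltW.
Qed.

(** The box is cut across axis [j] into m+1 slices of thickness [w j * h]. The image of each fits in
    a box lengthened along axis [i] by 2|t| times that thickness, and these boxes have total volume
    [p.[h]]. *)
Lemma dilates_transvection (i j : 'I_n.+1) (t : R) : i != j ->
  dilates (mulmx (1%:M + t *: delta_mx i j)) 1.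
Proof.
move=> ij; apply: dilates_open_box => // a b ab; rewrite mul1r.
pose w l := b l 0 - a l 0.
pose r := \prod_(l | (l != j) && (l != i)) w l.
pose p : {poly R} := ((w i)%:P + (2 * `|t| * w j) *: 'X) * (w j * r)%:P.
set T := mulmx _.
have Tx x l : T x l 0 = x l 0 + (if l == i then t * x j 0 else 0).
  rewrite /T mulmxDl mul1mx -scalemxAl mxE; congr (_ + _).
  rewrite mxE mxE (bigD1 j)//= big1 ?addr0 => [|l' l'j]; rewrite mxE;
    last by rewrite (negPf l'j) andbF mul0r.
  by rewrite eqxx andbT; case: ifP => _; rewrite ?mul1r ?mul0r ?mulr0.
have slices m : (mu (T @` open_box a b) <= p.[m.+1%:R^-1]%:E)%E.
  have h0 : 0 < m.+1%:R^-1 :> R by rewrite invr_gt0.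
  set h := m.+1%:R^-1 in h0 *.
  (* Slice [q] starts at [c q] along axis [j]. On it [t * x j 0] differs from [t * c q] by at most
     |t| times the thickness, which is the margin in [a'] and [b']. *)
  pose c (q : 'I_m.+1) := a j 0 + q%:R * (w j * h).
  pose a' q : 'cV[R]_n.+1 := \col_l (if l == j then c q else
    if l == i then a i 0 + t * c q - `|t| * (w j * h) else a l 0).
  pose b' q : 'cV[R]_n.+1 := \col_l (if l == j then c q + w j * h else
    if l == i then b i 0 + t * c q + `|t| * (w j * h) else b l 0).
  have w0 l : 0 <= w l by rewrite subr_ge0.
  have a'b' q l : a' q l 0 <= b' q l 0.
    have wjh : 0 <= w j * h by rewrite mulr_ge0 ?(ltW h0).
    have twjh : 0 <= `|t| * (w j * h) by rewrite mulr_ge0.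
    rewrite !mxE; have := ab l; case: eqP => [_|_]; first by rewrite lerDl.
    by case: eqP => [->|//]; lra.
  have vol q : box_volume (a' q) (b' q) = h * p.[h].
    rewrite /box_volume (bigD1 j)//= (bigD1 i)//= !mxE !eqxx (negPf ij).
    rewrite (eq_bigr w) => [|l /andP[lj li]]; last first.
      by rewrite !mxE (negPf lj) (negPf li).
    rewrite -/r /p hornerM hornerC hornerD hornerC hornerZ hornerX /w; ring.
  have -> : p.[h] = \sum_(q < m.+1) box_volume (a' q) (b' q).
    rewrite (eq_bigr (fun=> h * p.[h]))// sumr_const card_ord -mulr_natl mulrA.
    by rewrite divff ?mul1r.
  rewrite -sumEFin.
  apply: le_trans (_ : _ <= \sum_q mu (closed_box (a' q) (b' q)))%E _;
    last by apply: lee_sum => q _; exact: closed_box_outer.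
  apply: le_trans (lebesgue_outer_fin _ _).
  apply: le_lebesgue_outer => _ [x xab <-].
  have /andP[ax xb] := xab j.
  have wj0 : 0 < w j by rewrite subr_gt0 (lt_trans ax).
  have step0 : 0 < w j * h by rewrite mulr_gt0.
  (* Depth of [x] along axis [j] in units of the thickness; its integer part is the index of a slice
     containing [x]. *)
  pose z := (x j 0 - a j 0) / (w j * h).
  have z0 : 0 <= z by rewrite divr_ge0 ?subr_ge0 ?(ltW ax) ?(ltW step0).
  have /andP[qz zq] := truncn_itv z0.
  have qm : (Num.truncn z < m.+1)%N.
    rewrite -(ltr_nat R); apply: le_lt_trans qz _.
    rewrite ltr_pdivrMr// mulrCA divff// mulr1 /w; lra.
  move: qz zq; rewrite ler_pdivlMr// ltr_pdivrMr// -(natr1 (Num.truncn z)).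
  rewrite (mulrDl _ 1) mul1r => qz zq.
  exists (Ordinal qm) => // l; rewrite Tx !mxE.
  set s := _%:R * _ in qz zq; rewrite /c/= -/s.
  have [->|lj] := eqVneq l j.
    by rewrite eq_sym (negPf ij) addr0; lra.
  have [->|li] := eqVneq l i; last first.
    by rewrite addr0; have /andP[/ltW-> /ltW->] := xab l.
  have /andP[axi xbi] := xab i.
  have : `|t * (x j 0 - (a j 0 + s))| <= `|t| * (w j * h).
    rewrite normrM ler_wpM2l// ger0_norm; lra.
  rewrite ler_norml mulrBr => /andP[t1 t2]; apply/andP; split; lra.
have -> : box_volume a b = p.[0].
  rewrite /box_volume (bigD1 j)//= (bigD1 i)//= -/r.
  by rewrite /p hornerM hornerC hornerD hornerC hornerZ hornerX /w; ring.
exact: lee_horner0.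
Qed.

(** * From elementary matrices to all invertible ones *)

Lemma dilates_mulmx (A B : 'M[R]_n.+1) c d : 0 <= c ->
  dilates (mulmx A) c -> dilates (mulmx B) d ->
  dilates (mulmx (A *m B)) (c * d).
Proof.
move=> c0 Ac Bd.
have -> : mulmx (A *m B) = mulmx A \o mulmx B :> ('cV[R]_n.+1 -> _).
  by apply/funext => x /=; rewrite mulmxA.
exact: dilates_comp.
Qed.

Lemma dilates_mulmx1 : dilates (mulmx 1%:M) 1.
Proof.
move=> X; rewrite mul1e (_ : mulmx _ = id) ?image_id//.
by apply/funext => x; rewrite mul1mx.
Qed.

(** [T] is a sum of one-entry matrices with row in [S] and column outside [S]. Each of them gives a
    transvection, and the property [P] survives addition. *)
Lemma dilates_square_zero (S : pred 'I_n.+1) (T : 'M[R]_n.+1) :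
  (forall i j, T i j != 0 -> S i && ~~ S j) -> dilates (mulmx (1%:M + T)) 1.
Proof.
pose P (M : 'M[R]_n.+1) := (forall i j, M i j != 0 -> S i && ~~ S j) /\
  dilates (mulmx (1%:M + M)) 1.
have P0 : P 0.
  by split=> [i j|]; [rewrite mxE eqxx | rewrite addr0; exact: dilates_mulmx1].
(* [M *m N = 0], so that [1 + (M + N) = (1 + M) *m (1 + N)]. *)
have PD M N : P M -> P N -> P (M + N).
  move=> [MS Mdil] [NS Ndil]; split=> [i j|].
    rewrite mxE; have [->|/MS//] := eqVneq (M i j) 0.
    by rewrite add0r => /NS.
  have MN0 : M *m N = 0.
    apply/matrixP => i j; rewrite !mxE big1// => l _.
    have [->|/MS/andP[_ Sl]] := eqVneq (M i l) 0; first by rewrite mul0r.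
    have [->|/NS/andP[]] := eqVneq (N l j) 0; first by rewrite mulr0.
    by rewrite (negPf Sl).
  have -> : 1%:M + (M + N) = (1%:M + M) *m (1%:M + N).
    by rewrite mulmxDl !mulmxDr MN0 addr0 !mul1mx mulmx1 -addrA [N + M]addrC.
  by rewrite -[X in dilates _ X]mulr1; exact: dilates_mulmx.
move=> TS; suff [] : P T by [].
rewrite [T]matrix_sum_delta; apply: big_ind => // i _; apply: big_ind => // j _.
have [->|Tij] := eqVneq (T i j) 0; first by rewrite scale0r.
have /andP[Si Sj] := TS _ _ Tij; split=> [k l|].
  rewrite !mxE; have [->|_] := eqVneq k i; last by rewrite mulr0 eqxx.
  by have [->|_] := eqVneq l j; [rewrite Si Sj | rewrite mulr0 eqxx].
by apply: dilates_transvection; apply: contraNneq Sj => <-.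
Qed.

(* With [r i = i] (resp. [n - i]) this covers lower (resp. upper) unitriangular
   matrices. *)
Lemma dilates_unitriangular (r : 'I_n.+1 -> nat) (T : 'M[R]_n.+1) :
  (forall i j, T i j != 0 -> (r j < r i)%N) -> dilates (mulmx (1%:M + T)) 1.
Proof.
move=> Tr.
(* [U k] keeps the rows of rank at least [k]; the induction is on [d], a bound on how many ranks
   remain. *)
pose U k : 'M[R]_n.+1 := \matrix_(i, j) if (k <= r i)%N then T i j else 0.
suff Udil d : forall k, (forall i, r i < k + d)%N ->
    dilates (mulmx (1%:M + U k)) 1.
  have -> : T = U 0 by apply/matrixP => i j; rewrite mxE.
  by apply: (Udil (\max_i r i).+1) => i; rewrite ltnS; exact: leq_bigmax.
elim: d => [|d IHd] k rk.
  have -> : U k = 0.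
    by apply/matrixP => i j; rewrite !mxE leqNgt -[k]addn0 rk.
  by rewrite addr0; exact: dilates_mulmx1.
(* The rows of rank [k] split off as a left factor: their nonzero entries sit in columns of rank
   below [k], where the rows of [U k.+1] vanish. *)
pose V : 'M[R]_n.+1 := \matrix_(i, j) if r i == k then T i j else 0.
have -> : 1%:M + U k = (1%:M + V) *m (1%:M + U k.+1).
  have VU : V *m U k.+1 = 0.
    apply/matrixP => i j; rewrite !mxE big1// => l _; rewrite !mxE.
    case: eqP => [rik|_]; last by rewrite mul0r.
    have [->|/Tr rlk] := eqVneq (T i l) 0; first by rewrite mul0r.
    by rewrite leqNgt ltnS -rik ltnW ?mulr0.
  rewrite mulmxDl !mulmxDr VU addr0 !mul1mx mulmx1 -addrA; congr (_ + _).
  apply/matrixP => i j; rewrite !mxE.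
  by case: ltngtP => _; rewrite ?add0r ?addr0.
rewrite -[X in dilates _ X]mulr1; apply: dilates_mulmx => //.
  apply: (@dilates_square_zero (fun i => r i == k)) => i j; rewrite mxE.
  case: (r i =P k) => [<- /Tr|_]; last by rewrite eqxx.
  by rewrite ltn_neqAle => /andP[].
by apply: IHd => i; rewrite addSnnS.
Qed.

Lemma dilates_unitmx (A : 'M[R]_n.+1) : A \in unitmx ->
  dilates (mulmx A) `|\det A|.
Proof.
move=> Au.
have := cormen_lup_correct A; have := cormen_lup_perm A.
have := cormen_lup_detL A; have := @cormen_lup_lower _ _ A.
have := @cormen_lup_upper _ _ A.
case: cormen_lup => [[P L] U]/= Uup Llow detL /is_perm_mxP[s ->] PA.
have detU : \det U = \prod_j U j j.
  rewrite -det_tr det_trig.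
    by apply: eq_bigr => j _; rewrite mxE.
  by apply/is_trig_mxP => i j ij; rewrite mxE Uup.
have AE : A = perm_mx s^-1 *m L *m U.
  by rewrite -mulmxA -[L *m U]PA mulmxA -perm_mxM mulVg perm_mx1 mul1mx.
have detA : `|\det A| = 1 * 1 * (\prod_j `|U j j| * 1).
  rewrite AE !det_mulmx detL detU det_perm !normrM normr_prod normrX normrN1.
  by rewrite expr1n normr1 !mulr1.
have U0 j : U j j != 0.
  move: Au; rewrite unitmxE unitfE -normr_eq0 detA !mul1r mulr1.
  by move=> /prodf_neq0/(_ j isT); rewrite normr_eq0.
pose d : 'rV[R]_n.+1 := \row_j U j j.
(* Dividing each row by its nonzero pivot leaves an upper unitriangular matrix. *)
have UE : U = diag_mx d *m (1%:M + (diag_mx (\row_j (U j j)^-1) *m U - 1%:M)).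
  rewrite addrC subrK; apply/matrixP => i j.
  by rewrite !mul_diag_mx !mxE mulVKf.
suff Udil : dilates (mulmx U) (\prod_j `|U j j| * 1).
  rewrite detA AE; apply: dilates_mulmx => //.
    apply: dilates_mulmx => //; first exact: dilates_perm.
    have -> : L = 1%:M + (L - 1%:M) by rewrite addrC subrK.
    apply: (@dilates_unitriangular val) => i j.
    rewrite !mxE ltnNge; apply: contraNN => ij.
    by rewrite Llow// subrr.
rewrite [in mulmx _]UE; apply: dilates_mulmx; first exact: prodr_ge0.
  have -> : \prod_j `|U j j| = \prod_j `|d 0 j|.
    by apply: eq_bigr => j _; rewrite mxE.
  by apply: dilates_diag => j; rewrite mxE.
(* Indices are at most [n], so truncated subtraction strictly reverses their order. *)
apply: (@dilates_unitriangular (fun i => n - i)%N) => i j.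
rewrite mul_diag_mx !mxE; have [<-|ij] := eqVneq i j.
  by rewrite mulVf// subrr eqxx.
rewrite subr0 => Uij; have : ~~ (j < i)%N.
  by apply: contraNN Uij => ji; rewrite (Uup i j ji) mulr0.
have : (i != j :> nat) by [].
by have := ltn_ord i; have := ltn_ord j; lia.
Qed.

(** * Coverings by integer translates *)

(** Scaling by 1/N carries this cube onto the unit cube, so the upper bound on the image becomes a
    lower bound on the cube. *)
Lemma nat_cube_outer_ge (N : nat) : (0 < N)%N ->
  ((N%:R ^+ n.+1)%:E <= mu (closed_box 0 (const_mx N%:R)))%E.
Proof.
move=> N0; have NR : 0 < N%:R :> R by rewrite ltr0n.
have Nu : (N%:R^-1)%:M \in @unitmx R n.+1.
  by rewrite unitmxE det_scalar unitfE expf_neq0// gt_eqF ?invr_gt0.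
have := dilates_unitmx _ Nu (closed_box 0 (const_mx N%:R)).
rewrite det_scalar ger0_norm ?exprn_ge0 ?invr_ge0 ?ler0n// exprVn.
rewrite lee_pdivlMl ?exprn_gt0//; apply: le_trans.
rewrite -[leLHS]mule1 lee_pmul2l ?lte_fin ?exprn_gt0//.
apply: le_trans unit_cube_outer_ge1 _; apply: le_lebesgue_outer => x x01.
exists (N%:R *: x); last first.
  by rewrite mul_scalar_mx scalerA mulVf ?gt_eqF// scale1r.
move=> j; have := x01 j; rewrite !mxE => /andP[x0 x1].
by rewrite mulr_ge0 ?ler0n//= ler_piMr// ler0n.
Qed.

Lemma Zn_covering_outer {k : nat} (v : 'I_k -> 'cV[R]_n.+1)
    (D : set 'cV[R]_n.+1) (r : R) :
  (forall d, D d -> forall j, `|d j 0| <= r) ->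
  (forall x, exists d i (z : 'cV[int]_n.+1),
    D d /\ x = d + v i + map_mx intr z) ->
  (1 <= k%:R%:E * mu D)%E.
Proof.
move=> Dr Dcov.
have k0 : (0 < k)%N.
  by have [_ [i _]] := Dcov 0; exact: leq_ltn_trans (leq0n i) (ltn_ord i).
have : (0 <= mu D)%E := lebesgue_outer_ge0 D.
case muD : (mu D) => [M| |//] M0; last first.
  by rewrite gt0_muley ?lte_fin ?ltr0n// leey.
rewrite -EFinM lee_fin; rewrite lee_fin in M0.
(* [C] bounds all coordinates of d + v_i with d in [D], so points of [0, N]^(n+1) only involve
   integer vectors with coordinates from -C to N + C. *)
pose C := (Num.truncn (r + \sum_i \sum_j `|v i j 0|)).+1.
have DC d i j : D d -> `|d j 0 + v i j 0| <= C%:R.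
  move=> Dd; have vij : `|v i j 0| <= \sum_i \sum_j `|v i j 0|.
    rewrite (bigD1 i)//= (bigD1 j)//= -addrA lerDl addr_ge0 ?sumr_ge0// => l _.
    exact: sumr_ge0.
  have r0 : 0 <= r := le_trans (normr_ge0 _) (Dr d Dd j).
  apply: le_trans (ler_normD _ _) _; apply: le_trans (lerD (Dr d Dd j) vij) _.
  by rewrite ltW// truncnS_gt.
(* At 1/N this is k (N + 2C + 1)^(n+1) M divided by N^(n+1). *)
pose p : {poly R} := (k%:R * M) *: (1%:P + (C.*2.+1)%:R *: 'X) ^+ n.+1.
have -> : k%:R * M = p.[0].
  rewrite /p hornerZ horner_exp hornerD hornerC hornerZ hornerX.
  by rewrite mulr0 addr0 expr1n mulr1.
(* The N + 2C + 1 possible values of an integer coordinate are shifted by [C] and encoded as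
   ordinals. *)
apply: le_horner0 => m; set N := m.+1.
pose I : finType := ('I_k * {ffun 'I_n.+1 -> 'I_(N + C.*2).+1})%type.
pose t (i : I) : 'cV[R]_n.+1 := v i.1 + \col_j ((i.2 j)%:R - C%:R).
have cube : closed_box 0 (const_mx N%:R) `<=`
    \bigcup_(i : I) [set d + t i | d in D].
  move=> x xN; have [d [i [z [Dd xE]]]] := Dcov x.
  have zC j : 0 <= z j 0 + C%:Z <= (N + C.*2)%:Z.
    have xj := xN j; have := DC d i j Dd; rewrite ler_norml => dC.
    rewrite -!(ler_int R) !intrD -!pmulrn mulr0n.
    move: xj dC; rewrite xE !mxE -addnn !natrD; lra.
  pose f : {ffun 'I_n.+1 -> 'I_(N + C.*2).+1} :=
    [ffun j => inord (absz (z j 0 + C%:Z)%R)].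
  exists (i, f) => //; exists d => //; rewrite xE -!addrA; congr (_ + (_ + _)).
  apply/colP => j; rewrite !mxE ffunE inordK; last first.
    by have := zC j; lia.
  have /andP[z0 _] := zC j.
  by rewrite pmulrn gez0_abs// intrD -pmulrn addrK.
have : N%:R ^+ n.+1 <= k%:R * (N + C.*2).+1%:R ^+ n.+1 * M.
  rewrite -lee_fin; apply: le_trans (nat_cube_outer_ge N isT) _.
  apply: le_trans (le_lebesgue_outer cube) _.
  apply: le_trans (lebesgue_outer_fin _ _) _.
  apply: (@le_trans _ _ (\sum_(i : I) M%:E)%E).
    apply: lee_sum => i _; rewrite -muD -[leRHS]mul1e.
    exact: (dilates_translation (t i) D).
  rewrite sumEFin sumr_const card_prod card_ffun !card_ord -[M *+ _]mulr_natl.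
  by rewrite natrM natrX.
have N0 : 0 < N%:R ^+ n.+1 :> R by rewrite exprn_gt0.
move=> /le_trans le_trans_N; rewrite -(ler_pM2l N0) mulr1; apply: le_trans_N.
rewrite /p hornerZ horner_exp hornerD hornerC hornerZ hornerX.
rewrite -mulrA [X in _ * X]mulrC mulrA mulrCA -exprMn mulrDr mulr1.
by rewrite mulrCA divff ?mulr1 ?gt_eqF ?ltr0n// -natrD addnS.
Qed.

End BoxMeasure.

(** * Reduction of the theorem to integer translates *)

Lemma bounded_set_coord {R : realType} {n : nat} (D : set 'cV[R]_n) :
  bounded_set D -> exists M, forall d, D d -> forall j, `|d j 0| <= M.
Proof.
(* [DM] bounds the norm by every number strictly above [M], hence [M + 1]; the norm is the largest
   absolute value of an entry. *)
move=> [M [_ DM]]; exists (M + 1) => d Dd j.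
apply: le_trans (DM (M + 1) _ d Dd); last by rewrite ltrDl.
rewrite [leRHS]/Num.norm /= mx_normrE; apply/bigmax_geP; right => /=.
by exists (j, 0).
Qed.

Theorem theorem2p5 (R : realType) (n k : nat) (n_gt0 : (0 < n)%N)
    (k_gt0 : (0 < k)%N)
    (L : set 'cV[R]_n) (v : 'I_k -> 'cV[R]_n) (V D : set 'cV[R]_n) :
  full_lattice L ->
  (forall i j : 'I_k, (i < j)%N -> ~ L (v i - v j)) ->
  V = \bigcup_i [set v i + x | x in L] ->
  bounded_set D ->
  lebesgue_measurable D ->
  minkowski_sum D V = [set: 'cV[R]_n] ->
  ((lattice_det L / k%:R)%:E <= vol D)%E.
Proof.
move=> _ _ VE /bounded_set_coord[M DM] _ DV.
case: n n_gt0 => // {}n _ in L v V D VE DM DV *.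
have [[B [Bu LB]]|noB] := pselect (exists B, B \in unitmx /\ L = Zspan B);
  last first.
  (* Every full lattice has a basis, but this need not be proved: without one,
     [lattice_det] has the default value 0. *)
  rewrite /lattice_det xgetPN ?mul0r ?lebesgue_outer_ge0// => _ [B LB _].
  by apply: noB; exists B.
rewrite (lattice_detE Bu LB).
have detB : 0 < `|\det B| by rewrite normr_gt0 -unitfE -unitmxE.
pose D' : set 'cV[R]_n.+1 := mulmx (invmx B) @` D.
have D'le : (vol D' <= (`|\det B|^-1)%:E * vol D)%E.
  rewrite -normfV -det_inv; apply: dilates_unitmx.
  by rewrite unitmx_inv.
have D'1 : (1 <= k%:R%:E * vol D')%E.
  apply: (@Zn_covering_outer _ _ _ (fun i => invmx B *m v i) _
      (* Summing over all rows gives one bound for every coordinate of B^-1 d. *)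
      (\sum_i \sum_j `|invmx B i j| * M)) => [_ [d Dd <-] j|x].
    have M0 : 0 <= M := le_trans (normr_ge0 _) (DM d Dd j).
    rewrite mxE; apply: le_trans (ler_norm_sum _ _ _) _.
    rewrite [leRHS](bigD1 j)//= -[leLHS]addr0 lerD//.
      by apply: ler_sum => l _; rewrite normrM ler_wpM2l// DM.
    by apply: sumr_ge0 => l _; apply: sumr_ge0 => l' _; rewrite mulr_ge0.
  (* The covering is used at [B *m x] and pulled back by B^-1, which turns the lattice vector B z
     into z. *)
  have : minkowski_sum D V (B *m x) by rewrite DV.
  move=> [d Dd [w]]; rewrite VE LB => -[i _ [_ [z _ <-] <-]] dE.
  exists (invmx B *m d), i, z; split; first by exists d.
  by rewrite -[LHS](mulKmx Bu) -dE !mulmxDr mulKmx// addrA.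
have k0 : 0 < k%:R :> R by rewrite ltr0n.
rewrite EFinM muleC lee_pdivrMl// -[leLHS]mule1 -lee_pdivlMl//.
by apply: le_trans D'1 _; rewrite muleCA lee_wpmul2l ?lee_fin.
Qed.
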